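(* Let $\Bbbk$ be a field and $G$ a graph that is prime over $\Bbbk$ with minimum degree $\delta(G)\ge 2$. Let $x\in V(G)$ and $N_G(x)=Y\cup Z$ be a partition with $Y\neq\emptyset$ and $Z\neq\emptyset$. Then $\mathcal{L}_x(G;Y,Z)$ is prime over $\Bbbk$.
   Context: $\operatorname{reg}_{\Bbbk}(G)=\max\{j\ge0:\widetilde H_{j-1}(\operatorname{Ind}(G[S]);\Bbbk)\neq0\text{ for some }S\subseteq V(G)\}$, $\operatorname{Ind}$ the independence complex. A connected graph $H$ is prime over $\Bbbk$ if $\operatorname{reg}_{\Bbbk}(H-v)<\operatorname{reg}_{\Bbbk}(H)$ for every vertex $v$. The Lozin transform $\mathcal{L}_x(G;Y,Z)$: delete $x$, add four new vertices $y,a,b,z$ with edges $ya,ab,bz$, and join $y$ to every vertex of $Y$ and $z$ to every vertex of $Z$. *)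

(* Defs.v *)
From HB Require Import structures.
From mathcomp Require Import all_boot all_order all_algebra.
Set Implicit Arguments. Unset Strict Implicit. Unset Printing Implicit Defensive.
Import GRing.Theory.
Local Open Scope ring_scope.

(* A (finite simple) graph is given by a vertex set V : {set T} inside a
   finite type T together with an adjacency relation e : rel T (only its
   restriction to V matters). *)

Section Graphs.
Variable T : finType.

Definition indep (e : rel T) (s : {set T}) : bool :=
  [forall u in s, forall w in s, ~~ e u w].

Definition faces (e : rel T) (S : {set T}) (j : nat) : {set {set T}} :=
  [set s : {set T} | [&& s \subset S, indep e s & #|s| == j]].

(* Simplicial boundary matrix (row-vector convention) from the chain group
   with basis A to the chain group with basis B; vertices are totally ordered
   by enum_rank, and the face s :\ v of s gets the sign (-1)^(#{u in s | u < v}). *)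
Definition bdmx (K : fieldType) (A B : {set {set T}}) : 'M[K]_(#|A|, #|B|) :=
  \matrix_(i, l)
    \sum_(v in @enum_val _ (mem A) i)
      ((@enum_val _ (mem B) l == (@enum_val _ (mem A) i) :\ v)%:R *
       (-1) ^+ #|[set u in @enum_val _ (mem A) i | (enum_rank u < enum_rank v)%N]|).

(* Reduced homology  H~_{j-1}(Ind(G[S]); K) <> 0 :
   cycles (kernel of the boundary C_{j-1} -> C_{j-2}) are not all boundaries
   (image of C_j -> C_{j-1}).  Here C_{j-1} has basis the faces of size j;
   for j = 0 the outgoing boundary is the zero map (formula gives 0). *)
Definition hnz (K : fieldType) (e : rel T) (S : {set T}) (j : nat) : bool :=
  ~~ (kermx (bdmx K (faces e S j) (faces e S j.-1))
        <= bdmx K (faces e S j.+1) (faces e S j))%MS.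

(* reg_K(G) = max { j : H~_{j-1}(Ind(G[S])) <> 0 for some S subset V }.
   Faces have size <= #|T|, so only j <= #|T| can contribute. *)
Definition reg (K : fieldType) (e : rel T) (V : {set T}) : nat :=
  \max_(S : {set T} | S \subset V) \max_(j < #|T|.+2 | hnz K e S j) (j : nat).

Definition connected (e : rel T) (V : {set T}) : bool :=
  (V != set0) &&
  [forall u in V, forall w in V,
     connect (fun a b => [&& a \in V, b \in V & e a b]) u w].

Definition prime_graph (K : fieldType) (e : rel T) (V : {set T}) : bool :=
  connected e V && [forall v in V, reg K e (V :\ v) < reg K e V]%N.

Definition nbhd (e : rel T) (V : {set T}) (v : T) : {set T} :=
  [set u in V | e v u].

Definition min_deg_ge (e : rel T) (V : {set T}) (d : nat) : bool :=
  [forall v in V, d <= #|nbhd e V v|]%N.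

Definition simple_graph (e : rel T) : Prop := symmetric e /\ irreflexive e.

(* Lozin transform L_x(G;Y,Z): vertex type T + 'I_4, with
   y = inr 0, a = inr 1, b = inr 2, z = inr 3. *)
Definition lozinV (V : {set T}) (x : T) : {set (T + 'I_4)%type} :=
  (inl @: (V :\ x)) :|: [set inr i | i : 'I_4].

Definition lozinE (e : rel T) (Y Z : {set T}) : rel (T + 'I_4)%type :=
  fun p q =>
    match p, q with
    | inl u, inl w => e u w
    | inr i, inr j => ((i : nat).+1 == j) || ((j : nat).+1 == i)
    | inl u, inr i => (((i : nat) == 0%N) && (u \in Y)) || (((i : nat) == 3%N) && (u \in Z))
    | inr i, inl u => (((i : nat) == 0%N) && (u \in Y)) || (((i : nat) == 3%N) && (u \in Z))
    end.

End Graphs.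

(* Main.v *)
Require Import Defs.
From mathcomp Require Import all_boot all_order all_algebra.
(* Write M for the graph [lozinE e Y Z] on all of T + 'I_4: it contains G (the image
   of inl) together with the path y - a - b - z, and the Lozin transform L is M - x.
   Deleting x from M, or deleting y from M, does not change the homology of the
   independence complex, because the independence complexes of M - N[x] and M - N[y]
   are acyclic.  In M - y the vertex a is a leaf at b, and M - y - N[b] is G, so
   Ind(M - y) is a suspension of Ind(G).  Hence H_j(Ind L) = H_(j-1)(Ind G), which
   is nonzero in the top degree reg(G) + 1 because a prime graph attains its
   regularity only on its full vertex set.  For a proper vertex subset S of L, the
   long exact sequence of deletion and link bounds the degrees with nonzero homology
   by reg(G): it reduces S to proper induced subgraphs of G. *)
Set Implicit Arguments. Unset Strict Implicit. Unset Printing Implicit Defensive.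
Import GRing.Theory.
Local Open Scope ring_scope.

(** * Chains as functions on vertex sets: boundary, cone, splitting at a vertex *)

Section Chains.
Variables (K : fieldType) (T : finType).
Implicit Types (f g : {ffun {set T} -> K}) (t s S : {set T}) (u v w : T).

Definition vsign (v : T) (t : {set T}) : K :=
  (-1) ^+ #|[set u in t | (enum_rank u < enum_rank v)%N]|.

(** This is the boundary of the full simplex on [T], read coefficientwise; the graph enters only
    through [carried]. *)
Definition bdry (f : {ffun {set T} -> K}) : {ffun {set T} -> K} :=
  [ffun t : {set T} => \sum_(v | v \notin t) vsign v t * f (v |: t)].

(** Exterior multiplication by [v]: the terms of [f] that already contain [v] are killed. *)
Definition cone (v : T) (f : {ffun {set T} -> K}) : {ffun {set T} -> K} :=
  [ffun t : {set T} => if v \in t then vsign v t * f (t :\ v) else 0].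

Definition link_part (v : T) (f : {ffun {set T} -> K}) : {ffun {set T} -> K} :=
  [ffun t : {set T} => if v \in t then 0 else vsign v t * f (v |: t)].

Definition del_part (v : T) (f : {ffun {set T} -> K}) : {ffun {set T} -> K} :=
  [ffun t : {set T} => if v \in t then 0 else f t].

Definition avoids (v : T) (f : {ffun {set T} -> K}) : Prop :=
  forall t : {set T}, v \in t -> f t = 0.

Lemma vsignK v t (c : K) : vsign v t * (vsign v t * c) = c.
Proof. by rewrite mulrA -expr2 sqrr_sign mul1r. Qed.

Lemma vsignU v w t : w \notin t ->
  vsign v (w |: t) = (-1) ^+ (enum_rank w < enum_rank v)%N * vsign v t.
Proof.
move=> wNt; rewrite /vsign -exprD; congr (_ ^+ _).
rewrite (cardsD1 w) !inE eqxx /=; congr (_ + _)%N.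
apply: eq_card => u; rewrite !inE.
by case: eqVneq => [->|] //=; rewrite (negPf wNt).
Qed.

Lemma vsignU1 v t : vsign v (v |: t) = vsign v t.
Proof.
rewrite /vsign; congr (_ ^+ _); apply: eq_card => u; rewrite !inE.
by case: eqVneq => [->|] //=; rewrite ltnn andbF.
Qed.

Lemma vsignD1 v t : v \in t -> vsign v (t :\ v) = vsign v t.
Proof. by move=> vt; rewrite -vsignU1 setD1K. Qed.

Lemma bdryD f g : bdry (f + g) = bdry f + bdry g.
Proof.
apply/ffunP => t; rewrite !ffunE -big_split /=.
by apply: eq_bigr => v _; rewrite ffunE mulrDr.
Qed.

Lemma bdryN f : bdry (- f) = - bdry f.
Proof.
apply/ffunP => t; rewrite !ffunE -sumrN.
by apply: eq_bigr => v _; rewrite ffunE mulrN.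
Qed.

Lemma bdry0 : bdry 0 = 0.
Proof. by apply/ffunP => t; rewrite !ffunE big1 // => v _; rewrite ffunE mulr0. Qed.

Lemma bdry_avoids v f : avoids v f -> avoids v (bdry f).
Proof.
by move=> fv t vt; rewrite ffunE big1 // => w _; rewrite fv ?mulr0 // !inE vt orbT.
Qed.

(** The homotopy identity of a cone: removing the apex returns [f], while removing any other vertex
    anticommutes with adding the apex. *)
Lemma bdry_cone v f : bdry (cone v f) = f - cone v (bdry f).
Proof.
apply/ffunP => t; rewrite !ffunE; case: ifPn => [vt|vNt]; last first.
  rewrite subr0 (bigD1 v) //= big1 ?addr0 => [|w /andP[_ wv]].
    by rewrite !ffunE setU11 vsignU1 vsignK setU1K.
  by rewrite !ffunE !inE (negPf vNt) eq_sym (negPf wv) mulr0.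
(* In the boundary at [t :\ v] the summand of [v] itself cancels [f t]; the remaining summands match
   one by one. *)
rewrite [in RHS](bigD1 v) ?setD11 //= setD1K // mulrDr.
rewrite vsignD1 // vsignK opprD addrA subrr sub0r mulr_sumr -sumrN.
apply: eq_big => [w|w wNt].
  by rewrite !inE negb_and negbK; case: (eqVneq w v) => [->|]; rewrite ?vt ?andbT.
have wv : w != v by apply: contraNneq wNt => ->.
rewrite !ffunE !inE vt orbT.
have -> : (w |: t) :\ v = w |: (t :\ v).
  by apply/setP => u; rewrite !inE; case: (eqVneq u w) => [->|]; rewrite ?wv.
rewrite (vsignU v wNt) -[X in vsign w X](setD1K vt) vsignU ?setD11 //.
(* Exactly one of [v], [w] precedes the other, so the two orders of operation differ by one sign. *)
have -> : ((enum_rank v < enum_rank w) = ~~ (enum_rank w < enum_rank v))%N.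
  rewrite -leqNgt ltn_neqAle andb_idl // => _.
  by apply: contra wv => /eqP/val_inj/enum_rank_inj ->.
rewrite -!mulrA !(mulrCA _ (vsign w _)) !(mulrCA _ (vsign v t)) -!mulrN.
congr (_ * (_ * _)); case: (_ < _)%N; rewrite /= ?expr0 ?expr1 !(mul1r, mulN1r) //.
Qed.

Lemma chain_split v f : f = del_part v f + cone v (link_part v f).
Proof.
apply/ffunP => t; rewrite !ffunE; case: ifPn => vt; rewrite ?addr0 ?add0r //.
by rewrite setD11 setD1K // vsignD1 // vsignK.
Qed.

Lemma del_part_avoids v f : avoids v (del_part v f).
Proof. by move=> t vt; rewrite ffunE vt. Qed.

Lemma link_part_avoids v f : avoids v (link_part v f).
Proof. by move=> t vt; rewrite ffunE vt. Qed.

Lemma cone_split_inj v f f' g g' :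
  avoids v f -> avoids v f' -> avoids v g -> avoids v g' ->
  f + cone v g = f' + cone v g' -> f = f' /\ g = g'.
Proof.
move=> fv f'v gv g'v /ffunP E; split; apply/ffunP => t.
  have := E t; rewrite !ffunE; case: ifPn => vt; last by rewrite !addr0.
  by rewrite (fv t) // (f'v t).
have [vt|vt] := boolP (v \in t); first by rewrite gv // g'v.
have := E (v |: t); rewrite !ffunE setU11 fv ?setU11 // f'v ?setU11 // !add0r.
by rewrite setU1K // => /(congr1 ( *%R (vsign v (v |: t)))); rewrite !vsignK.
Qed.

(** In the coordinates deletion and link, the boundary is that of a mapping cone whose connecting
    map is the inclusion of the link. *)
Lemma bdry_split v f :
  bdry f = (bdry (del_part v f) + link_part v f)
           + cone v (- bdry (link_part v f)).
Proof.
rewrite {1}(chain_split v f) bdryD bdry_cone addrA; congr (_ + _).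
by apply/ffunP => t; rewrite !ffunE; case: ifP; rewrite ?oppr0 ?mulrN.
Qed.

Lemma avoidsD v f g : avoids v f -> avoids v g -> avoids v (f + g).
Proof. by move=> fv gv t vt; rewrite ffunE fv // gv // addr0. Qed.

Lemma avoidsN v f : avoids v f -> avoids v (- f).
Proof. by move=> fv t vt; rewrite ffunE fv // oppr0. Qed.

Lemma avoids0 v : avoids v 0.
Proof. by move=> t _; rewrite ffunE. Qed.

Lemma bdry_splitP v f h k : avoids v h -> avoids v k ->
  bdry f = h + cone v k ->
  bdry (del_part v f) + link_part v f = h /\ bdry (link_part v f) = - k.
Proof.
move=> hv kv; rewrite (bdry_split v f) => E.
have dv := bdry_avoids (@del_part_avoids v f).
have lv := @link_part_avoids v f.
have [] := cone_split_inj _ _ _ _ E => //.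
- exact: avoidsD.
- exact/avoidsN/bdry_avoids.
- by move=> -> <-; rewrite opprK.
Qed.

Lemma bdry_split_avoids v f h : avoids v h -> bdry f = h ->
  bdry (del_part v f) + link_part v f = h /\ bdry (link_part v f) = 0.
Proof.
move=> hv fh; rewrite -[0 in X in _ /\ X]oppr0; apply: bdry_splitP => //.
  exact: avoids0.
by rewrite fh; apply/ffunP => t; rewrite !ffunE mulr0 if_same addr0.
Qed.

(** The grading counts vertices, so these chains have homological degree [j - 1]. *)
Definition carried (e : rel T) (S : {set T}) (j : nat) (f : {ffun {set T} -> K}) :=
  forall t : {set T}, f t != 0 -> t \in faces e S j.

Lemma carriedD e S j f g : carried e S j f -> carried e S j g -> carried e S j (f + g).
Proof.
move=> Hf Hg t; rewrite ffunE; case: (eqVneq (f t) 0) => [->|/Hf //].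
by rewrite add0r => /Hg.
Qed.

Lemma carriedN e S j f : carried e S j f -> carried e S j (- f).
Proof. by move=> Hf t; rewrite ffunE oppr_eq0 => /Hf. Qed.

Lemma carried0 e S j : carried e S j 0.
Proof. by move=> t; rewrite ffunE eqxx. Qed.

Lemma carried_sub e S S' j f :
  S \subset S' -> carried e S j f -> carried e S' j f.
Proof.
move=> SS' Hf t /Hf; rewrite !inE => /and3P[tS -> ->].
by rewrite (subset_trans tS SS').
Qed.

Lemma carried_avoids e S j f v : v \notin S -> carried e S j f -> avoids v f.
Proof.
move=> vS Hf t vt; apply/eqP; apply: contraNT vS => /Hf; rewrite inE.
by case/and3P => /subsetP/(_ v vt).
Qed.

End Chains.

(** * From boundary matrices to chains *)

Section MatrixChains.
Variables (K : fieldType) (T : finType).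
Implicit Types (A B : {set {set T}}).

Definition row_chain A (u : 'rV[K]_#|A|) : {ffun {set T} -> K} :=
  [ffun t : {set T} => \sum_i (enum_val i == t)%:R * u 0 i].

Definition chain_row A (f : {ffun {set T} -> K}) : 'rV[K]_#|A| :=
  \row_i f (enum_val i).

Lemma chain_rowK A (u : 'rV[K]_#|A|) : chain_row A (row_chain u) = u.
Proof.
apply/rowP => i; rewrite !mxE ffunE (bigD1 i) //= eqxx mul1r big1 ?addr0 // => k ki.
by rewrite (inj_eq enum_val_inj) (negPf ki) mul0r.
Qed.

Lemma row_chain_out A (u : 'rV[K]_#|A|) t : t \notin A -> row_chain u t = 0.
Proof.
move=> tA; rewrite ffunE big1 // => i _; case: eqP => [E|]; rewrite ?mul0r //.
by rewrite -E enum_valP in tA.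
Qed.

(** Pairs of a face [s] and [v] in [s] with [s :\ v = t] correspond to vertices [v] outside [t] with
    [s = v |: t]; exchanging the two sums turns the matrix product into [bdry]. *)
Lemma chain_row_bdry A B (f : {ffun {set T} -> K}) :
  (forall t, f t != 0 -> t \in A) ->
  chain_row A f *m bdmx K A B = chain_row B (bdry f).
Proof.
move=> fA; apply/rowP => l; rewrite !mxE ffunE.
under eq_bigr => i _ do rewrite !mxE.
set t := enum_val l.
rewrite -(big_enum_val (fun s => f s * \sum_(v in s) ((t == s :\ v)%:R * vsign K v s))) /=.
under eq_bigr => s _ do rewrite mulr_sumr.
rewrite (exchange_big_dep xpredT) //= (bigID (fun v => v \notin t)) /=.
rewrite [X in _ + X]big1 ?addr0 => [|v]; last first.
  rewrite negbK => vt; rewrite big1 // => s _.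
  by case: eqP => [E|]; rewrite ?mul0r ?mulr0 //; move: vt; rewrite E setD11.
apply: eq_bigr => v vt.
have [vA|vA] := boolP (v |: t \in A); last first.
  have -> : f (v |: t) = 0 by apply/eqP; apply: contraNT vA => /fA.
  rewrite mulr0 big1 // => s /andP[sA vs].
  case: eqP => [E|]; rewrite ?mul0r ?mulr0 //.
  by rewrite E setD1K // sA in vA.
rewrite (bigD1 (v |: t)) ?vA ?setU11 //= setU1K // eqxx mul1r vsignU1 mulrC.
rewrite big1 ?addr0 // => s /andP[/andP[sA vs] sn].
case: eqP => [E|]; rewrite ?mul0r ?mulr0 //.
by rewrite E setD1K // eqxx in sn.
Qed.

Lemma chain_row_inj A (f g : {ffun {set T} -> K}) :
  (forall t, f t != 0 -> t \in A) -> (forall t, g t != 0 -> t \in A) ->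
  chain_row A f = chain_row A g -> f = g.
Proof.
move=> fA gA /rowP E; apply/ffunP => t.
have [tA|tA] := boolP (t \in A).
  by have := E (enum_rank_in tA t); rewrite !mxE enum_rankK_in.
have -> : f t = 0 by apply/eqP; apply: contraNT tA => /fA.
by apply/esym/eqP; apply: contraNT tA => /gA.
Qed.

Lemma indepS (e : rel T) (s t : {set T}) : s \subset t -> indep e t -> indep e s.
Proof.
move=> /subsetP st /forall_inP H; apply/forall_inP => u /st/H/forall_inP Hu.
by apply/forall_inP => w /st/Hu.
Qed.

Lemma bdry_carried (e : rel T) S j (f : {ffun {set T} -> K}) :
  carried e S j f -> carried e S j.-1 (bdry f).
Proof.
move=> Hf t; rewrite ffunE => nz.
have [v vt] : exists2 v, v \notin t & f (v |: t) != 0.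
  apply/exists_inP; apply: contraNT nz; rewrite negb_exists_in => /forall_inP H.
  by apply/eqP/big1 => v vt; rewrite (eqP (negbNE (H v vt))) mulr0.
move/Hf; rewrite !inE => /and3P[tS ti /eqP <-].
rewrite (subset_trans (subsetUr _ _) tS) (indepS (subsetUr _ _) ti) /=.
by rewrite cardsU1 vt.
Qed.

Lemma carried_row_chain (e : rel T) S j (u : 'rV[K]_#|faces e S j|) :
  carried e S j (row_chain u).
Proof. by move=> t; apply: contraNT => /(row_chain_out u) ->. Qed.

(** All later arguments use this form: homology vanishes when every cycle can be filled. At [j = 0],
    where [j.-1] is again 0, both boundaries are zero because the empty face has no vertex to
    remove. *)
Lemma hnzPn (e : rel T) (S : {set T}) (j : nat) :
  reflect (forall f : {ffun {set T} -> K}, carried e S j f -> bdry f = 0 ->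
             exists2 g, carried e S j.+1 g & bdry g = f)
          (~~ hnz K e S j).
Proof.
have row0 (A : {set {set T}}) : chain_row A (0 : {ffun {set T} -> K}) = 0.
  by apply/rowP => l; rewrite !mxE ffunE.
have carr i (u : 'rV_#|faces e S i|) := @carried_row_chain e S i u.
rewrite negbK; apply: (iffP idP) => [sub f fS f0|fill].
  have : (chain_row (faces e S j) f <= bdmx K (faces e S j.+1) (faces e S j))%MS.
    by apply: submx_trans sub; apply/sub_kermxP; rewrite chain_row_bdry // f0 row0.
  case/submxP => D E; exists (row_chain D) => //.
  apply: (@chain_row_inj (faces e S j)) => //.
    exact: (bdry_carried (carr _ D)).
  rewrite -(chain_row_bdry (A := faces e S j.+1)); last exact: carr.
  by rewrite chain_rowK.
apply/row_subP => i; set u := row i _.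
have ku : u *m bdmx K (faces e S j) (faces e S j.-1) = 0.
  by apply/sub_kermxP; rewrite row_sub.
have [|g gS E] := fill (row_chain u) (carr _ u).
  move: ku; rewrite -{1}(chain_rowK u) chain_row_bdry; last exact: carr.
  rewrite -(row0 (faces e S j.-1)).
  apply: chain_row_inj; first exact: (bdry_carried (carr _ _)).
  by move=> t; rewrite ffunE eqxx.
by apply/submxP; exists (chain_row _ g); rewrite chain_row_bdry // E chain_rowK.
Qed.

End MatrixChains.

(** * The long exact sequence of deletion and link *)

Section LinkDeletion.
Variables (K : fieldType) (T : finType) (e : rel T).
Hypotheses (e_sym : symmetric e) (e_irr : irreflexive e).
Implicit Types (f g h k : {ffun {set T} -> K}) (t S : {set T}) (v : T).

(** This is S - N[v]; for [v] in [S], its independence complex is the link of [v] in Ind(G[S]). *)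
Definition nonnbhd S v : {set T} := [set u in S | (u != v) && ~~ e v u].

Lemma nonnbhd_subD1 S v : nonnbhd S v \subset S :\ v.
Proof. by apply/subsetP => u; rewrite !inE => /and3P[-> ->]. Qed.

Lemma indepP t :
  reflect (forall u w, u \in t -> w \in t -> ~~ e u w) (indep e t).
Proof.
apply: (iffP forall_inP) => [H u w ut wt|H u ut].
  exact: (forall_inP (H u ut)).
by apply/forall_inP => w; apply: H.
Qed.

Lemma del_part_carried S j v f :
  carried e S j f -> carried e (S :\ v) j (del_part v f).
Proof.
move=> Hf t; rewrite ffunE; case: ifPn => [_|vt /Hf]; first by rewrite eqxx.
by rewrite !inE subsetD1 vt => /and3P[-> -> ->].
Qed.

Lemma link_part_carried S j v f :
  carried e S j.+1 f -> carried e (nonnbhd S v) j (link_part v f).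
Proof.
move=> Hf t; rewrite ffunE; case: ifPn => [_|vt]; first by rewrite eqxx.
rewrite mulf_eq0 negb_or => /andP[_ /Hf].
rewrite !inE cardsU1 vt add1n eqSS => /and3P[/subsetP tS it ->].
rewrite (indepS (subsetUr [set v] t) it) !andbT; apply/subsetP => u ut.
rewrite !inE tS ?inE ?ut ?orbT //= (indepP _ it) ?setU11 ?inE ?ut ?orbT // andbT.
by apply: contraNneq vt => <-.
Qed.

Lemma link_part0 S v f : carried e S 0 f -> link_part v f = 0.
Proof.
move=> Hf; apply/ffunP => t; rewrite !ffunE; case: ifPn => // vt.
case: (eqVneq (f (v |: t)) 0) => [->|/Hf]; first by rewrite mulr0.
by rewrite !inE cardsU1 vt !andbF.
Qed.

Lemma cone_carried S j v f :
  v \in S -> carried e (nonnbhd S v) j f -> carried e S j.+1 (cone v f).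
Proof.
move=> vS Hf t; rewrite ffunE; case: ifPn => [vt|_]; last by rewrite eqxx.
rewrite mulf_eq0 negb_or => /andP[_ /Hf].
rewrite !inE => /and3P[/subsetP tS it /eqP tj].
rewrite (cardsD1 v t) vt tj add1n eqxx andbT; apply/andP; split.
  apply/subsetP => u ut; case: (eqVneq u v) => [->//|uv].
  by have := tS u; rewrite !inE uv ut => /(_ isT)/andP[].
have nv u : u \in t -> ~~ e v u.
  move=> ut; case: (eqVneq u v) => [->|uv]; first by rewrite e_irr.
  by have := tS u; rewrite !inE uv ut => /(_ isT)/andP[].
apply/indepP => u w ut wt; case: (eqVneq u v) => [->|uv]; first exact: nv.
case: (eqVneq w v) => [->|wv]; first by rewrite e_sym nv.
by apply: (indepP _ it); rewrite !inE ?uv ?wv.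
Qed.

Lemma nonnbhd_avoids S j v f : carried e (nonnbhd S v) j f -> avoids v f.
Proof. by apply: carried_avoids; rewrite !inE eqxx andbF. Qed.

Lemma del_avoids S j v f : carried e (S :\ v) j f -> avoids v f.
Proof. by apply: carried_avoids; rewrite setD11. Qed.

(* [hnz_delete0] to [hnz_link]: exactness, at each term, of the long exact sequence
   H_j(S - N[v]) -> H_j(S - v) -> H_j(S) -> H_(j-1)(S - N[v]) -> ... *)
Lemma hnz_delete0 S v : v \in S -> hnz K e S 0 -> hnz K e (S :\ v) 0.
Proof.
move=> vS; apply: contraTT => /hnzPn fill; apply/hnzPn => f fS f0.
have l0 := link_part0 v fS; have fv := chain_split v f.
have fd : f = del_part v f.
  by rewrite {1}fv l0; apply/ffunP => t; rewrite !ffunE mulr0 if_same addr0.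
have [|g gS gE] := fill f _ f0; first by rewrite fd; apply: del_part_carried.
by exists g => //; apply: carried_sub gS; apply: subsetDl.
Qed.

Lemma hnz_deleteS S v j : v \in S -> hnz K e S j.+1 ->
  hnz K e (S :\ v) j.+1 || hnz K e (nonnbhd S v) j.
Proof.
move=> vS; apply: contraTT; rewrite negb_or => /andP[/hnzPn fd /hnzPn fl].
apply/hnzPn => f fS f0.
have [E l0] := bdry_split_avoids (@avoids0 _ _ v) f0.
have [g gS gE] := fl _ (link_part_carried fS) l0.
have gd := carried_sub (nonnbhd_subD1 S v) gS.
have [||h hS hE] := fd (del_part v f + g).
- exact/carriedD/gd/del_part_carried.
- by rewrite bdryD gE.
(* [g] fills the link part of [f] and [h] fills the corrected cycle [del_part v f + g]; the two
   copies of [g] cancel. *)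
exists (h - cone v g).
  apply: carriedD; first exact: carried_sub (subsetDl _ _) hS.
  exact/carriedN/cone_carried.
rewrite bdryD bdryN bdry_cone gE hE [in RHS](chain_split v f).
by rewrite opprB addrACA subrr addr0.
Qed.

Lemma hnz_undelete S v j : hnz K e (S :\ v) j ->
  hnz K e S j || hnz K e (nonnbhd S v) j.
Proof.
apply: contraTT; rewrite negb_or => /andP[/hnzPn fS /hnzPn fl].
apply/hnzPn => f fd f0.
have [g gS gE] := fS f (carried_sub (subsetDl _ _) fd) f0.
have [E l0] := bdry_split_avoids (del_avoids fd) gE.
have [k kS kE] := fl _ (link_part_carried gS) l0.
(* Since [f] avoids [v], the link part of its filling [g] is a cycle; its filling [k] replaces the
   part of [g] through [v]. *)
exists (del_part v g + k); last by rewrite bdryD kE.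
exact: carriedD (del_part_carried gS) (carried_sub (nonnbhd_subD1 S v) kS).
Qed.

Lemma hnz_link S v j : v \in S -> hnz K e (nonnbhd S v) j ->
  hnz K e (S :\ v) j || hnz K e S j.+1.
Proof.
move=> vS; apply: contraTT; rewrite negb_or => /andP[/hnzPn fd /hnzPn fS].
apply/hnzPn => f fl f0.
have [|g gS gE] := fd f _ f0; first exact: carried_sub (nonnbhd_subD1 S v) fl.
(* [f] is filled both by [g] in the deletion and by [cone v f] in the star of [v]; the difference is
   a cycle, and the link part of its filling [k] fills [f]. *)
have [||k kS kE] := fS (g - cone v f).
- apply: carriedD; first exact: carried_sub (subsetDl _ _) gS.
  exact/carriedN/cone_carried.
- rewrite bdryD bdryN bdry_cone gE f0.
  by apply/ffunP => t; rewrite !ffunE mulr0 if_same subr0 subrr.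
have fv := nonnbhd_avoids fl; have gv := del_avoids gS.
exists (link_part v k); first exact: link_part_carried.
have [|_ ->] := bdry_splitP gv (avoidsN fv) (f := k); last by rewrite opprK.
rewrite kE; congr (_ + _); apply/ffunP => t; rewrite !ffunE.
by case: ifP; rewrite ?oppr0 ?mulrN.
Qed.

(** An isolated vertex is a cone apex, so [cone v f] fills every cycle [f]. *)
Lemma hnz_isolated S v j : v \in S -> nonnbhd S v = S :\ v -> ~~ hnz K e S j.
Proof.
move=> vS iso; apply/hnzPn => f fS f0.
exists (cone v f); last first.
  rewrite bdry_cone f0.
  by apply/ffunP => t; rewrite !ffunE mulr0 if_same subr0.
rewrite [X in cone v X](chain_split v f).
have -> : cone v (del_part v f + cone v (link_part v f)) = cone v (del_part v f).
  by apply/ffunP => t; rewrite !ffunE setD11 addr0.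
by apply: cone_carried => //; rewrite iso; apply: del_part_carried.
Qed.

End LinkDeletion.

(** * Invariance under order-preserving induced embeddings *)

Section Embedding.
Variables (K : fieldType) (T T' : finType) (q : T -> T').
Hypothesis q_inj : injective q.
Hypothesis q_mono : forall u v,
  (enum_rank (q u) < enum_rank (q v))%N = (enum_rank u < enum_rank v)%N.

Definition pull_chain (g : {ffun {set T'} -> K}) : {ffun {set T} -> K} :=
  [ffun t : {set T} => g (q @: t)].

Definition push_chain (f : {ffun {set T} -> K}) : {ffun {set T'} -> K} :=
  [ffun t : {set T'} => if t \subset q @: setT then f (q @^-1: t) else 0].

Lemma imset_preimset (t : {set T'}) : t \subset q @: setT -> q @: (q @^-1: t) = t.
Proof.
move=> /subsetP tq; apply/setP => w; apply/imsetP/idP => [[u + ->]|wt].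
  by rewrite inE.
by have /imsetP[u _ E] := tq w wt; exists u; rewrite // inE -E.
Qed.

Lemma preimset_imset (t : {set T}) : q @^-1: (q @: t) = t.
Proof. by apply/setP => u; rewrite inE mem_imset. Qed.

Lemma push_chainK : cancel push_chain pull_chain.
Proof. by move=> f; apply/ffunP => t; rewrite !ffunE imsetS ?subsetT // preimset_imset. Qed.

(** The signs depend on the enumeration order, which is why [q] must preserve the order of ranks as
    well as adjacency. *)
Lemma vsign_imset v (t : {set T}) : vsign K (q v) (q @: t) = vsign K v t.
Proof.
rewrite /vsign; congr (_ ^+ _); rewrite -(card_imset _ q_inj); apply: eq_card => w.
rewrite !inE; apply/andP/imsetP => [[/imsetP[u ut ->] uv]|[u + ->]].
  by exists u; rewrite // inE ut -q_mono.
by rewrite inE q_mono => /andP[ut ->]; rewrite imset_f.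
Qed.

Definition in_range (g : {ffun {set T'} -> K}) :=
  forall t, g t != 0 -> t \subset q @: setT.

Lemma pull_chainK g : in_range g -> push_chain (pull_chain g) = g.
Proof.
move=> gq; apply/ffunP => t; rewrite !ffunE; case: ifPn => tq.
  by rewrite imset_preimset.
by apply/esym/eqP; apply: contraNT tq => /gq.
Qed.

Lemma bdry_pull g : in_range g -> bdry (pull_chain g) = pull_chain (bdry g).
Proof.
move=> gq; apply/ffunP => t; rewrite !ffunE.
(* Vertices outside the image of [q] contribute nothing, as [g] is supported on subsets of the
   image. *)
rewrite [RHS](bigID (mem (q @: setT))) /= [X in _ = _ + X]big1 ?addr0; last first.
  move=> w /andP[_ wq]; case: (eqVneq (g (w |: q @: t)) 0) => [->|/gq]; rewrite ?mulr0 //.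
  by move=> /subsetP/(_ w (setU11 _ _)); rewrite (negPf wq).
rewrite (eq_bigl (fun w => w \in q @: [set v | v \notin t])) => [|w]; last first.
  apply/andP/imsetP => [[wt /imsetP[v _ E]]|[v + ->]].
    by exists v; rewrite // inE; move: wt; rewrite E mem_imset.
  by rewrite inE mem_imset // imset_f ?inE.
rewrite big_imset /=; last by move=> u v _ _; apply: q_inj.
apply: eq_big => [v|v _]; first by rewrite inE.
by rewrite vsign_imset ffunE imsetU imset_set1.
Qed.

Lemma bdry_in_range g : in_range g -> in_range (bdry g).
Proof.
move=> gq t; apply: contraNT => tq; rewrite ffunE big1 // => w _.
case: (eqVneq (g (w |: t)) 0) => [->|/gq]; rewrite ?mulr0 // subUset.
by rewrite (negPf tq) andbF.
Qed.

Lemma push_in_range f : in_range (push_chain f).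
Proof. by move=> t; rewrite ffunE; case: ifP; rewrite ?eqxx. Qed.

Lemma bdry_push f : bdry (push_chain f) = push_chain (bdry f).
Proof.
rewrite -{2}[f]push_chainK bdry_pull ?pull_chainK //; last exact: push_in_range.
exact/bdry_in_range/push_in_range.
Qed.

Variables (e : rel T) (e' : rel T').
Implicit Types (S : {set T}).
Hypothesis q_edge : forall u v, e' (q u) (q v) = e u v.

Lemma faces_imset S j (t : {set T}) : (q @: t \in faces e' (q @: S) j) = (t \in faces e S j).
Proof.
rewrite !inE card_imset //; congr [&& _, _ & _].
  apply/idP/idP => [|/imsetS //]; move=> /subsetP H; apply/subsetP => u ut.
  by have := H (q u); rewrite !mem_imset // => /(_ ut).
apply/indepP/indepP => H u w; first by move=> ut wt; rewrite -q_edge H ?imset_f.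
by move=> /imsetP[u' ut ->] /imsetP[w' wt ->]; rewrite q_edge H.
Qed.

Lemma pull_carried S j g : carried e' (q @: S) j g -> carried e S j (pull_chain g).
Proof. by move=> gS t; rewrite ffunE => /gS; rewrite faces_imset. Qed.

Lemma push_carried S j f : carried e S j f -> carried e' (q @: S) j (push_chain f).
Proof.
move=> fS t; rewrite ffunE; case: ifPn => [tq /fS|_]; last by rewrite eqxx.
by rewrite -faces_imset imset_preimset.
Qed.

Lemma carried_in_range (S : {set T}) j g : carried e' (q @: S) j g -> in_range g.
Proof.
move=> gS t /gS; rewrite inE => /and3P[tS _ _].
by apply: subset_trans tS (imsetS _ (subsetT _)).
Qed.

Lemma hnz_imset (S : {set T}) j : hnz K e' (q @: S) j = hnz K e S j.
Proof.
apply: negb_inj; apply/hnzPn/hnzPn => fill f fS f0.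
  have [||g gS gE] := fill (push_chain f); first exact: push_carried.
    by rewrite bdry_push f0; apply/ffunP => t; rewrite !ffunE if_same.
  exists (pull_chain g); first exact: pull_carried.
  by rewrite bdry_pull ?gE ?push_chainK //; apply: carried_in_range gS.
have fr := carried_in_range fS.
have [||g gS gE] := fill (pull_chain f); first exact: pull_carried.
  by rewrite bdry_pull // f0; apply/ffunP => t; rewrite !ffunE.
exists (push_chain g); first exact: push_carried.
by rewrite bdry_push gE pull_chainK.
Qed.

End Embedding.

(** The enumeration of a sum type lists the left summand first, so [inl] keeps every rank. *)
Lemma enum_rank_inl_ltn (T T' : finType) (u v : T) :
  (enum_rank (inl u : T + T')%type < enum_rank (inl v : T + T')%type)%N
  = (enum_rank u < enum_rank v)%N.
Proof.
have inlE w : enum_rank (inl w : T + T')%type = enum_rank w :> nat.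
  pose s := enum T.
  have -> : enum_rank w = index w s :> nat.
    rewrite -[in RHS](enum_rankK w) /enum_val index_uniq ?enum_uniq //.
    by rewrite -cardE.
  have -> : enum_rank (inl w : T + T')%type = index (inl w) (enum {: T + T'}) :> nat.
    rewrite -[in RHS](enum_rankK (inl w)) /enum_val index_uniq ?enum_uniq //.
    by rewrite -cardE.
  rewrite enumT unlock /= /sum_enum index_cat map_f -?enumT ?mem_enum //.
  rewrite index_map //.
  exact: inl_inj.
by rewrite !inlE.
Qed.

(** * Regularity and where it is attained *)

Section Regularity.
Variables (K : fieldType) (T : finType) (e : rel T).
Implicit Types (S V : {set T}).

Lemma hnz_le_card S j : hnz K e S j -> (j <= #|T|)%N.
Proof.
apply: contraTT; rewrite -ltnNge => jT; apply/hnzPn => f fS _.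
exists 0; first exact: carried0.
rewrite bdry0; apply/esym/ffunP => t; rewrite [RHS]ffunE; apply/eqP.
apply: contraTT jT => /fS; rewrite inE => /and3P[_ _ /eqP <-].
by rewrite -leqNgt max_card.
Qed.

Lemma hnz_le_reg S V j : S \subset V -> hnz K e S j -> (j <= reg K e V)%N.
Proof.
move=> SV Sj; have jT : (j < #|T|.+2)%N by rewrite ltnS ltnW // ltnS (hnz_le_card Sj).
apply: leq_trans (leq_bigmax_cond _ SV) => /=.
exact: (@leq_bigmax_cond _ (fun i : 'I_#|T|.+2 => hnz K e S i) _ (Ordinal jT)).
Qed.

Lemma reg_leP V n :
  reflect (forall S j, S \subset V -> hnz K e S j -> (j <= n)%N) (reg K e V <= n)%N.
Proof.
apply: (iffP idP) => [le S j SV Sj|H]; first exact: leq_trans (hnz_le_reg SV Sj) le.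
by apply/bigmax_leqP => S SV; apply/bigmax_leqP => j; apply: H.
Qed.

(** Every proper subset lies in some [V :\ v], where the maximum is not reached, so it is reached on
    [V] itself. *)
Lemma hnz_reg V : (forall v, v \in V -> reg K e (V :\ v) < reg K e V)%N ->
  V != set0 -> hnz K e V (reg K e V).
Proof.
move=> crit /set0Pn[v0 v0V]; apply: contraPT (leqnn (reg K e V)) => nV.
(* Positivity makes the predecessor of [reg K e V] genuine, so bounding the regularity by it is a
   contradiction. *)
have r0 : (0 < reg K e V)%N by apply: leq_ltn_trans (crit v0 v0V).
apply/negP; rewrite -ltnNge -[X in (_ < X)%N](ltn_predK r0) ltnS.
apply/reg_leP => S j SV Sj.
rewrite -ltnS (ltn_predK r0).
have [SE|SnV] := eqVneq S V.
  rewrite ltn_neqAle (hnz_le_reg SV Sj) andbT.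
  by apply: contraNneq nV => <-; rewrite -SE.
have /properP[_ [v vV vS]] : S \proper V by rewrite properEneq SnV.
by apply: leq_ltn_trans (crit v vV); apply: hnz_le_reg Sj; rewrite subsetD1 SV.
Qed.

End Regularity.

(** * Degree bounds from the exact sequence *)

Section DegreeBounds.
Variables (K : fieldType) (T : finType) (e : rel T).
Hypotheses (e_sym : symmetric e) (e_irr : irreflexive e).
Implicit Types (S Q : {set T}) (v : T) (j k : nat).

(* [hbounded S 0] says that Ind(G[S]) is acyclic. *)
Definition hbounded S k : Prop := forall j, hnz K e S j -> (j < k)%N.

Lemma hboundedW S k k' : (k <= k')%N -> hbounded S k -> hbounded S k'.
Proof. by move=> kk Sk j /Sk jk; apply: leq_trans jk kk. Qed.

Lemma in_nonnbhd S v u : (u \in nonnbhd e S v) = [&& u \in S, u != v & ~~ e v u].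
Proof. by rewrite inE. Qed.

(** The link enters the exact sequence one degree lower, so its bound is smaller by one. For [v]
    outside [S] the deletion is [S] itself, which spares callers a case distinction. *)
Lemma hbounded_step S v k :
  hbounded (S :\ v) k.+1 -> hbounded (nonnbhd e S v) k -> hbounded S k.+1.
Proof.
have [vS|vS] := boolP (v \in S); last first.
  suff -> : S :\ v = S by [].
  by apply/setP => u; rewrite !inE; case: eqVneq => // ->; rewrite (negPf vS).
move=> Sd Sl [|j] // /(hnz_deleteS e_sym e_irr vS) /orP[/Sd //|/Sl].
by rewrite ltnS.
Qed.

Lemma hbounded0_step S v : v \in S ->
  hbounded (S :\ v) 0 -> hbounded (nonnbhd e S v) 0 -> hbounded S 0.
Proof.
move=> vS Sd Sl [|j]; first by move/(hnz_delete0 vS)/Sd.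
by case/(hnz_deleteS e_sym e_irr vS)/orP => [/Sd|/Sl].
Qed.

Lemma hbounded0_isolated S v : v \in S -> (forall u, u \in S -> ~~ e v u) ->
  hbounded S 0.
Proof.
move=> vS iso j; apply: contraTT => _; apply: hnz_isolated vS _ => //.
apply/setP => u; rewrite in_nonnbhd !inE andbC -andbA; congr (_ && _).
by have [/iso ->|] := boolP (u \in S); rewrite ?andbF.
Qed.

Lemma hnz_del_acyclic_link S v j : v \in S -> hbounded (nonnbhd e S v) 0 ->
  hnz K e S j = hnz K e (S :\ v) j.
Proof.
move=> vS Sl; apply/idP/idP; last by case/hnz_undelete/orP => // /Sl.
case: j => [|j]; first exact: hnz_delete0.
by case/(hnz_deleteS e_sym e_irr vS)/orP => // /Sl.
Qed.

(** With an acyclic deletion the connecting map to the link is an isomorphism. *)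
Lemma hnz_suspension S v j : v \in S -> hbounded (S :\ v) 0 ->
  hnz K e S j.+1 = hnz K e (nonnbhd e S v) j.
Proof.
move=> vS Sd; apply/idP/idP; first by case/(hnz_deleteS e_sym e_irr vS)/orP => // /Sd.
by case/(hnz_link e_sym e_irr vS)/orP => // /Sd.
Qed.

(* Both graphs are obtained from G[c |: Q] by deleting one of the twins p, c. *)
Lemma hnz_twin Q p c j : p \in Q -> c \notin Q -> ~~ e c p ->
  (forall u, u \in Q :\ p -> e p u = e c u) ->
  hnz K e Q j = hnz K e (c |: (Q :\ p)) j.
Proof.
move=> pQ cQ cp tw; have pc : p != c by apply: contraTneq pQ => ->.
have neighb u : u \in c |: Q -> e c u = e p u.
  rewrite !inE => /orP[/eqP ->|uQ]; first by rewrite e_irr e_sym (negPf cp).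
  have [->|up] := eqVneq u p; first by rewrite e_irr (negPf cp).
  by rewrite tw // !inE up.
have -> : Q = (c |: Q) :\ c by rewrite setU1K.
have -> : c |: (((c |: Q) :\ c) :\ p) = (c |: Q) :\ p.
  rewrite setU1K //; apply/setP => u; rewrite !inE.
  by case: (eqVneq u c) => [->|] //=; rewrite eq_sym pc.
rewrite -!hnz_del_acyclic_link ?setU11 ?inE ?pQ ?orbT //.
  (* The link of [p] still contains its twin [c], whose neighbours are all gone, so [c] is isolated
     there; the link of [c] is treated with the roles exchanged. *)
  apply: (@hbounded0_isolated _ c) => [|u].
    by rewrite in_nonnbhd setU11 eq_sym pc e_sym cp.
  by rewrite in_nonnbhd => /and3P[uQ _]; rewrite neighb.
apply: (@hbounded0_isolated _ p) => [|u].
  by rewrite in_nonnbhd !inE pQ orbT pc cp.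
by rewrite in_nonnbhd => /and3P[uQ _]; rewrite neighb.
Qed.

End DegreeBounds.

(** * The Lozin transform as a suspension of G, up to homology *)

Section Lozin.
Variables (K : fieldType) (T : finType) (e : rel T) (V : {set T}) (x : T).
Variables (Y Z : {set T}).
Hypotheses (e_sym : symmetric e) (e_irr : irreflexive e) (xV : x \in V).
Hypothesis YZ : Y :|: Z = nbhd e V x.

Local Notation U := (T + 'I_4)%type.
Local Notation E := (lozinE e Y Z).
Local Notation VL := (lozinV V x).
Local Notation "'X" := (inl x : U).
Let o0 : 'I_4 := @Ordinal 4 0 isT.
Let o1 : 'I_4 := @Ordinal 4 1 isT.
Let o2 : 'I_4 := @Ordinal 4 2 isT.
Let o3 : 'I_4 := @Ordinal 4 3 isT.
Local Notation y := (inr o0 : U).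
Local Notation a := (inr o1 : U).
Local Notation b := (inr o2 : U).
Local Notation z := (inr o3 : U).
Implicit Types (S Q : {set U}).

Variant ord4_spec : 'I_4 -> Type :=
  | Ord4_0 : ord4_spec o0 | Ord4_1 : ord4_spec o1
  | Ord4_2 : ord4_spec o2 | Ord4_3 : ord4_spec o3.

Lemma ord4P k : ord4_spec k.
Proof.
case: k => [[|[|[|[|//]]]] lt].
- by rewrite (_ : Ordinal lt = o0); [constructor | apply: val_inj].
- by rewrite (_ : Ordinal lt = o1); [constructor | apply: val_inj].
- by rewrite (_ : Ordinal lt = o2); [constructor | apply: val_inj].
- by rewrite (_ : Ordinal lt = o3); [constructor | apply: val_inj].
Qed.

Lemma inl_eqE (u w : T) : ((inl u : U) == inl w) = (u == w). Proof. by []. Qed.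
Lemma inr_eqE (i k : 'I_4) : ((inr i : U) == inr k) = (i == k :> nat). Proof. by []. Qed.
Lemma inlr_eqE u i : ((inl u : U) == inr i) = false. Proof. by []. Qed.
Lemma inrl_eqE u i : ((inr i : U) == inl u) = false. Proof. by []. Qed.
Let vE := (inE, inl_eqE, inr_eqE, inlr_eqE, inrl_eqE, in_nonnbhd).

Lemma lozinE_sym : symmetric E.
Proof. by move=> [u|i] [w|k] //=; rewrite orbC. Qed.

Lemma lozinE_irr : irreflexive E.
Proof. by move=> [u|i] //=; rewrite ?e_irr // orbb eqn_leq ltnn. Qed.

Lemma in_nbhdYZ u : u \in V -> e x u = (u \in Y) || (u \in Z).
Proof. by move=> uV; have /setP/(_ u) := YZ; rewrite !inE uV => ->. Qed.

Lemma x_notinY : x \notin Y.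
Proof. by apply/negP => xY; have := in_nbhdYZ xV; rewrite e_irr xY. Qed.

Lemma x_notinZ : x \notin Z.
Proof. by apply/negP => xZ; have := in_nbhdYZ xV; rewrite e_irr xZ orbT. Qed.

Lemma lozinE_x i : E 'X (inr i) = false.
Proof. by rewrite /= (negPf x_notinY) (negPf x_notinZ) !andbF. Qed.

Lemma lozinE_x' i : E (inr i) 'X = false.
Proof. by rewrite lozinE_sym lozinE_x. Qed.

Lemma in_lozinV_inl u : (inl u \in VL) = (u != x) && (u \in V).
Proof.
rewrite !inE mem_imset; last exact: inl_inj.
by rewrite !inE orbC; case: imsetP => [[]//|].
Qed.

Lemma in_lozinV_inr i : inr i \in VL.
Proof. by rewrite inE orbC imset_f. Qed.

Local Notation acyclic S := (hbounded K E S 0).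
Let isol := hbounded0_isolated (K := K) lozinE_sym lozinE_irr.

(* In G[x |: S] both x and y have an acyclic link, so either may be deleted;
   once y is gone, a is a leaf at b, which makes the graph a suspension. *)
Lemma hnz_lozin S : 'X \notin S -> (forall i, inr i \in S) ->
  (forall u, inl u \in S -> u \in V) ->
  hbounded K E (((('X |: S) :\ y)) :\ b) 0 /\
  (forall j, hnz K E S j = hnz K E (('X |: S) :\ y) j).
Proof.
move=> xS pS SV; split.
  apply: (isol (v := a)) => [|[u|k]]; rewrite ?vE ?pS //=.
  by case: (ord4P k); rewrite ?vE.
move=> j; rewrite -[in LHS](setU1K xS).
rewrite -!hnz_del_acyclic_link ?setU11 ?inE ?pS ?orbT //;
  try exact: lozinE_sym; try exact: lozinE_irr.
(* The link of [y]: without [z], the vertex [b] is isolated; in the link of [z], no vertex of [Y] or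
   [Z] survives and [x] is isolated. *)
- apply: (hbounded0_step lozinE_sym lozinE_irr (v := z)).
  + by rewrite !vE pS.
  + apply: (isol (v := b)); first by rewrite !vE pS.
    by case=> [u|k] //; case: (ord4P k); rewrite ?vE ?andbF.
  apply: (isol (v := 'X)); first by rewrite !vE eqxx !lozinE_x'.
  case=> [u|k]; last by rewrite lozinE_x.
  rewrite !vE /=; case: (eqVneq u x) => [->|ux]; first by rewrite e_irr.
  rewrite orbF => /andP[/andP[uS uY] uZ].
  by rewrite in_nbhdYZ ?SV // negb_or uY uZ.
(* The link of [x] has no vertex of [Y] or [Z]: without [b], the vertex [z] is isolated; in the link
   of [b], the vertex [y] is. *)
apply: (hbounded0_step lozinE_sym lozinE_irr (v := b)).
- by rewrite !vE pS !lozinE_x.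
- apply: (isol (v := z)); first by rewrite !vE pS !lozinE_x.
  case=> [u|k]; last by case: (ord4P k); rewrite ?vE ?andbF.
  rewrite !vE /=; case: (eqVneq u x) => [->|ux] /=; first by rewrite x_notinZ.
  by move=> /andP[/SV uV]; rewrite in_nbhdYZ // negb_or => /andP[].
apply: (isol (v := y)); first by rewrite !vE pS !lozinE_x.
case=> [u|k]; last by case: (ord4P k); rewrite ?vE ?andbF.
rewrite !vE /= orbF; case: (eqVneq u x) => [->|ux] /=; first by rewrite x_notinY.
by move=> /andP[/andP[/SV uV]]; rewrite in_nbhdYZ // negb_or => /andP[].
Qed.

(** The poles [a] and [z] are neighbours of [b], and [y] is deleted, so only vertices of G remain,
    with [x] restored. *)
Lemma nonnbhd_b S : 'X \notin S -> (forall i, inr i \in S) ->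
  nonnbhd E (('X |: S) :\ y) b = 'X |: inl @: [set u | inl u \in S].
Proof.
move=> xS pS; apply/setP => -[u|k]; rewrite !vE /=.
  by rewrite mem_imset ?inE ?andbT //; apply: inl_inj.
have -> : (inr k \in inl @: [set u | inl u \in S]) = false by apply/imsetP => -[].
by case: (ord4P k); rewrite ?andbF.
Qed.

Lemma hnz_inl (W : {set T}) j : hnz K E (inl @: W) j = hnz K e W j.
Proof. by apply: hnz_imset => //; [exact: inl_inj | exact: enum_rank_inl_ltn]. Qed.

Lemma hnz_lozinV j : hnz K E VL j.+1 = hnz K e V j.
Proof.
have xS : 'X \notin VL by rewrite in_lozinV_inl eqxx.
have SV u : inl u \in VL -> u \in V by rewrite in_lozinV_inl => /andP[].
have [Sd ->] := hnz_lozin xS in_lozinV_inr SV.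
rewrite (hnz_suspension lozinE_sym lozinE_irr _ _ Sd); last first.
  by rewrite in_setD1 in_setU1 in_lozinV_inr.
rewrite nonnbhd_b //; last exact: in_lozinV_inr.
rewrite -hnz_inl; congr (hnz K E _ j); apply/setP => -[u|k]; last first.
  by rewrite !inE; apply/idP/imsetP => [/imsetP[]|[]].
rewrite in_setU1 inl_eqE !mem_imset; try exact: inl_inj.
by rewrite in_set in_lozinV_inl; case: eqVneq => [->|].
Qed.

(** * Homology of proper induced subgraphs of the transform *)

Variable r : nat.
Hypothesis r_bound : forall W : {set T}, W \proper V -> hbounded K e W r.

(** The absent vertex [u0] makes the subset of [V] proper, so that [r_bound] applies. *)
Lemma hbounded_inl Q u0 : (forall i, inr i \notin Q) ->
  (forall u, inl u \in Q -> u \in V) -> u0 \in V -> inl u0 \notin Q ->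
  hbounded K E Q r.
Proof.
move=> Qr QV u0V u0Q.
have -> : Q = inl @: [set u | inl u \in Q].
  apply/setP => -[u|k]; first by rewrite mem_imset ?inE //; apply: inl_inj.
  by rewrite (negPf (Qr k)); apply/esym/imsetP => -[].
move=> j; rewrite hnz_inl; apply: r_bound; apply/properP; split.
  by apply/subsetP => u; rewrite inE => /QV.
by exists u0; rewrite ?inE.
Qed.

(* If the only pole in Q sees what x would see there, x can replace it. *)
Lemma hbounded_pole Q i u0 : (forall k, inr k \in Q -> k = i) ->
  (forall u, inl u \in Q -> (u != x) && (u \in V)) ->
  (forall u, inl u \in Q -> E (inr i) (inl u) = e x u) ->
  u0 \in V -> u0 != x -> inl u0 \notin Q ->
  hbounded K E Q r.
Proof.
move=> Qi QV Qe u0V u0x u0Q.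
have [iQ|iQ] := boolP (inr i \in Q); last first.
  apply: (hbounded_inl _ _ u0V u0Q) => [k|u /QV/andP[] //].
  by apply: contra iQ => kQ; rewrite -(Qi k kQ).
move=> j; rewrite (hnz_twin K lozinE_sym lozinE_irr j iQ (c := 'X)).
(* After the exchange no pole is left, and [u0] is still absent. *)
- move: j; apply: (@hbounded_inl _ u0) => // [k|u|].
  + by rewrite !inE /= negb_and negbK; case: eqP => // /eqP; 
       rewrite inr_eqE => ki; apply/negP => /Qi kE; rewrite kE eqxx in ki.
  + by rewrite !inE /= => /orP[/eqP[->] //|/QV/andP[]].
  by rewrite !inE /= inl_eqE (negPf u0x).
- by apply/negP => /QV; rewrite eqxx.
- by rewrite lozinE_x.
case=> [u|k]; first by rewrite !inE /= => /Qe.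
by rewrite !inE => /andP[ki /Qi kE]; rewrite kE eqxx in ki.
Qed.

Hypotheses (Y0 : Y != set0) (Z0 : Z != set0).

Lemma YZ_V u : (u \in Y) || (u \in Z) -> (u != x) && (u \in V).
Proof.
move=> uYZ; have /setP/(_ u) := YZ; rewrite !inE uYZ => /esym/andP[-> xu].
by rewrite andbT; apply: contraTneq xu => ->; rewrite e_irr.
Qed.

(** With [Z] absent, [y] sees exactly the remaining neighbours of [x], and the nonempty [Z] supplies
    the missing vertex. *)
Lemma hbounded_y Q : (forall k, inr k \in Q -> k = o0) ->
  (forall u, inl u \in Q -> [&& u != x, u \in V & u \notin Z]) ->
  hbounded K E Q r.
Proof.
move=> Qk QV; have /set0Pn[u0 u0Z] := Z0.
have /andP[u0x u0V] : (u0 != x) && (u0 \in V) by rewrite YZ_V // u0Z orbT.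
apply: (@hbounded_pole Q o0 u0) => // [u /QV/and3P[-> ->] //|u /QV/and3P[_ uV uZ]|].
  by rewrite in_nbhdYZ // (negPf uZ).
by apply/negP => /QV; rewrite u0Z !andbF.
Qed.

Lemma hbounded_z Q : (forall k, inr k \in Q -> k = o3) ->
  (forall u, inl u \in Q -> [&& u != x, u \in V & u \notin Y]) ->
  hbounded K E Q r.
Proof.
move=> Qk QV; have /set0Pn[u0 u0Y] := Y0.
have /andP[u0x u0V] : (u0 != x) && (u0 \in V) by rewrite YZ_V // u0Y.
apply: (@hbounded_pole Q o3 u0) => // [u /QV/and3P[-> ->] //|u /QV/and3P[_ uV uY]|].
  by rewrite in_nbhdYZ // (negPf uY).
by apply/negP => /QV; rewrite u0Y !andbF.
Qed.

(** Here the missing vertex is [x]. *)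
Lemma hbounded_base Q : (forall k, inr k \notin Q) ->
  (forall u, inl u \in Q -> (u != x) && (u \in V)) -> hbounded K E Q r.
Proof.
move=> Qk QV; apply: (@hbounded_inl Q x) => // [u /QV/andP[] //|].
by apply/negP => /QV; rewrite eqxx.
Qed.

Let step S v k := @hbounded_step K U E lozinE_sym lozinE_irr S v k.

(** The poles present in [S] decide where to cut: at a vertex whose deletion has bound [r.+1],
    mostly by being acyclic through an isolated pole, and whose link has bound [r]. *)
Lemma hbounded_lozin_proper S : S \proper VL -> hbounded K E S r.+1.
Proof.
case/properP => /subsetP SVL [p pVL pS].
have SV u : inl u \in S -> (u != x) && (u \in V) by move/SVL; rewrite in_lozinV_inl.
have [aS|aS] := boolP (a \in S); have [bS|bS] := boolP (b \in S).
(* Without [y], the vertex [a] is a leaf at [b]: deleting [b] isolates [a], and the link of [b]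
   contains no pole. Without [z], the same holds with [a] and [b] exchanged. *)
- have [yS|yS] := boolP (y \in S); last first.
    apply: (@step S b).
      apply: (@hboundedW _ _ _ _ 0) => //; apply: (isol (v := a)).
        by rewrite !vE aS.
      by case=> [u|k] //; case: (ord4P k); rewrite !vE ?(negPf yS) ?andbF.
    apply: hbounded_base => [k|u]; last by rewrite !vE => /andP[/SV].
    by rewrite !vE; case: (ord4P k); rewrite ?(negPf yS) ?andbF.
  have [zS|zS] := boolP (z \in S); last first.
    apply: (@step S a).
      apply: (@hboundedW _ _ _ _ 0) => //; apply: (isol (v := b)).
        by rewrite !vE bS.
      by case=> [u|k] //; case: (ord4P k); rewrite !vE ?(negPf zS) ?andbF.
    apply: hbounded_base => [k|u]; last by rewrite !vE => /andP[/SV].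
    by rewrite !vE; case: (ord4P k); rewrite ?(negPf zS) ?andbF.
  (* All four poles are present, so the missing vertex belongs to G - x, and the link of [b] is a
     proper induced subgraph of G. *)
  have xS : 'X \notin S by apply/negP => /SV; rewrite eqxx.
  have pS' i : inr i \in S by case: (ord4P i).
  have [|Sd SE] := hnz_lozin xS pS'; first by move=> u /SV/andP[].
  move=> j; rewrite SE; move: j; apply: (@step _ b).
    exact: hboundedW Sd.
  case: p pVL pS => [u0|k]; last by rewrite pS'.
  rewrite in_lozinV_inl => /andP[u0x u0V] u0S.
  rewrite nonnbhd_b //; apply: (@hbounded_inl _ u0) => // [k|u|].
  + by rewrite !inE /=; apply/imsetP => -[].
  + rewrite !inE mem_imset ?inE; last exact: inl_inj.
    by case/orP => [/eqP[->] //|/SV/andP[]].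
  rewrite !inE mem_imset ?inE; last exact: inl_inj.
  by rewrite inl_eqE (negPf u0x).
(* Without [b], only [y] can be a neighbour of [a]; in the link of [y], the only possible pole is
   [z] and [Y] is gone. *)
- have [yS|yS] := boolP (y \in S); last first.
    apply: (@hboundedW _ _ _ _ 0) => //; apply: (isol aS).
    by case=> [u|k] //; case: (ord4P k) => //; rewrite ?(negPf yS) ?(negPf bS).
  apply: (@step S y).
    apply: (@hboundedW _ _ _ _ 0) => //; apply: (isol (v := a)).
      by rewrite !vE aS.
    by case=> [u|k] //; case: (ord4P k); rewrite !vE ?(negPf bS) ?andbF.
  apply: hbounded_z => [k|u]; last first.
    by rewrite !vE /= orbF => /andP[/SV/andP[-> ->]].
  by rewrite !vE; case: (ord4P k); rewrite ?(negPf bS) ?andbF.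
- have [zS|zS] := boolP (z \in S); last first.
    apply: (@hboundedW _ _ _ _ 0) => //; apply: (isol bS).
    by case=> [u|k] //; case: (ord4P k) => //; rewrite ?(negPf zS) ?(negPf aS).
  apply: (@step S z).
    apply: (@hboundedW _ _ _ _ 0) => //; apply: (isol (v := b)).
      by rewrite !vE bS.
    by case=> [u|k] //; case: (ord4P k); rewrite !vE ?(negPf aS) ?andbF.
  apply: hbounded_y => [k|u]; last first.
    by rewrite !vE /= => /andP[/SV/andP[-> ->]].
  by rewrite !vE; case: (ord4P k); rewrite ?(negPf aS) ?andbF.
(* Neither [a] nor [b] is present: cut at [z], then at [y]. The link of [z] has lost [Z] and may
   keep [y]; everything else lies in G - x. *)
apply: (@step S z); last first.
  apply: hbounded_y => [k|u]; last first.
    by rewrite !vE /= => /andP[/SV/andP[-> ->]].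
  by rewrite !vE; case: (ord4P k); rewrite ?(negPf aS) ?(negPf bS) ?andbF.
apply: (@step _ y).
  apply: (@hboundedW _ _ _ _ r) => //; apply: hbounded_base => [k|u].
    by rewrite !vE; case: (ord4P k); rewrite ?(negPf aS) ?(negPf bS) ?andbF.
  by rewrite !vE => /SV.
apply: hbounded_base => [k|u]; last by rewrite !vE => /andP[/SV].
by rewrite !vE; case: (ord4P k); rewrite ?(negPf aS) ?(negPf bS) ?andbF.
Qed.

(** * Connectedness of the transform *)

Lemma connected_lozin : connected e V -> connected E VL.
Proof.
case/andP => _ /forall_inP eV; apply/andP; split.
  by apply/set0Pn; exists y; apply: in_lozinV_inr.
set L := (fun p q => [&& p \in VL, q \in VL & E p q]).
have L_sym : connect_sym L.
  by apply: sym_connect_sym => p q; rewrite /L lozinE_sym andbCA.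
(* [f] puts [y] in the place of [x], and [g] contracts the four poles back to [x]; walks of G are
   transported along [f], edge by edge. *)
pose f u : U := if u == x then y else inl u.
pose g (p : U) := if p is inl u then u else x.
have poles i : connect L y (inr i).
  have e1 (k k' : 'I_4) : (k.+1 == k' :> nat) -> connect L (inr k) (inr k').
    by move=> kk; apply: connect1; rewrite /L !in_lozinV_inr /= kk.
  have ya := e1 o0 o1 isT; have ab := e1 o1 o2 isT; have bz := e1 o2 o3 isT.
  case: (ord4P i) => //; first exact: connect_trans ya ab.
  exact: connect_trans ya (connect_trans ab bz).
have fg p : p \in VL -> connect L (f (g p)) p.
  case: p => [u|k] /=; rewrite /f ?eqxx //.
  by rewrite in_lozinV_inl => /andP[/negPf -> _].
have fx w : w \in V -> e x w -> connect L y (f w).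
  move=> wV xw; have wx : w != x by apply: contraTneq xw => ->; rewrite e_irr.
  rewrite /f (negPf wx); have := xw; rewrite in_nbhdYZ // => /orP[wY|wZ].
    by apply: connect1; rewrite /L in_lozinV_inr in_lozinV_inl wx wV /= wY.
  (* A neighbour in [Z] is reached from [y] through the whole path y - a - b - z. *)
  apply: connect_trans (poles o3) (connect1 _).
  by rewrite /L in_lozinV_inr in_lozinV_inl wx wV /= wZ.
have fedge u w : [&& u \in V, w \in V & e u w] -> connect L (f u) (f w).
  case/and3P => uV wV uw; have [ux|ux] := eqVneq u x.
    by rewrite {1}/f ux eqxx; apply: fx; rewrite // -ux.
  have [wx|wx] := eqVneq w x.
    by rewrite L_sym {1}/f wx eqxx; apply: fx; rewrite // e_sym -wx.
  rewrite /f (negPf ux) (negPf wx); apply: connect1.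
  by rewrite /L !in_lozinV_inl ux wx uV wV.
have gV p : p \in VL -> g p \in V.
  by case: p => [u|k] //=; rewrite in_lozinV_inl => /andP[].
apply/forall_inP => p pV; apply/forall_inP => q qV.
have /forall_inP/(_ _ (gV q qV))/connectP[s] := eV _ (gV p pV).
suff fpath u : path (fun a b => [&& a \in V, b \in V & e a b]) u s ->
    connect L (f u) (f (last u s)).
  move=> /fpath pq lq; rewrite -lq in pq.
  apply: connect_trans (fg q qV); apply: connect_trans pq.
  by rewrite L_sym; apply: fg.
elim: s u => [|w s IH] u //= /andP[uw /IH]; apply: connect_trans.
exact: fedge.
Qed.

End Lozin.

(* Primality of the transform *)
Local Close Scope ring_scope.

Theorem mainTheorem15 (K : fieldType) (T : finType) (e : rel T) (V : {set T})
  (x : T) (Y Z : {set T}) :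
  simple_graph e ->
  prime_graph K e V ->
  min_deg_ge e V 2 ->
  x \in V ->
  Y :|: Z = nbhd e V x ->
  [disjoint Y & Z] ->
  Y != set0 -> Z != set0 ->
  prime_graph K (lozinE e Y Z) (lozinV V x).
Proof.
move=> [e_sym e_irr] /andP[eV /forall_inP crit] _ xV YZ disYZ Y0 Z0.
have V0 : V != set0 by apply/set0Pn; exists x.
set r := reg K e V in crit.
have r_bound (W : {set T}) : W \proper V -> hbounded K e W r.
  case/properP => WV [v vV vW] j Wj; apply: leq_ltn_trans (crit v vV).
  by apply: hnz_le_reg Wj; rewrite subsetD1 WV.
rewrite /prime_graph connected_lozin //=; apply/forall_inP => p pV.
(* With L the transform: reg(L - p) is at most [r], and [r.+1] is at most reg(L). *)
apply: (@leq_ltn_trans r).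
  apply/reg_leP => S j; rewrite subsetD1 => /andP[SV pS] Sj.
  rewrite -ltnS; move: j Sj; apply: (@hbounded_lozin_proper K T e V x Y Z) => //.
  by apply/properP; split=> //; exists p.
(* The homology of G at its top index [r] is shifted to [r.+1] on the full vertex set of the
   transform. *)
apply: hnz_le_reg (subxx _) _; rewrite hnz_lozinV //.
exact: hnz_reg.
Qed.
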